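(* Let $X$ be an irreducible shift of finite type, let $Y$ be a sofic shift, and let $\pi\colon X \to Y$ be an almost invertible factor code. Let $\mu$ be a measure on $X$ which is fully supported, $\sigma$-invariant, ergodic, and $\mathfrak{T}_X$-nonsingular. Let $\nu = \pi_* \mu$. Then $\nu$ is $\mathfrak{T}_Y$-nonsingular. Moreover, if $\mu$ is Gibbs with respect to an additive cocycle $\phi\colon\mathfrak{T}_X\to\mathbb{R}$, then $\nu$ is Gibbs with respect to $\phi \circ (\pi^{-1} \times \pi^{-1})$, where $\pi^{-1}$ is well-defined $\nu$-almost everywhere (namely, $\pi^{-1}(y)$ is the unique $\pi$-preimage of $y$ for $y$ doubly transitive in $Y$).
   Context: A shift space is a closed subset $X\subseteq \mathcal{A}^{\mathbb{Z}}$ ($\mathcal{A}$ a finite discrete alphabet, product topology) that is invariant under the shift $\sigma$, $(\sigma^n x)_0=x_n$. $\mathcal{B}(X)$ is the set of finite words appearing in points of $X$. A shift of finite type is a shift space consisting of all points of $\mathcal{A}^{\mathbb{Z}}$ in which no word from some finite set of forbidden words appears. A factor code $\pi\colon X\to Y$ is a surjective continuous shift-equivariant map between shift spaces; a sofic shift is a shift space that is the image of a shift of finite type under a factor code. $X$ is irreducible if for all $u,v\in\mathcal{B}(X)$ there is $w\in\mathcal{B}(X)$ with $uwv\in\mathcal{B}(X)$. A point $x\in X$ is doubly transitive if every word of $\mathcal{B}(X)$ appears in $x$ infinitely often to the left and infinitely often to the right. A factor code $\pi\colon X\to Y$ from an irreducible shift of finite type onto an (automatically irreducible) sofic shift is almost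 invertible if every doubly transitive point of $Y$ has a unique $\pi$-preimage. All measures are Borel probability measures; ergodic means ergodic with respect to $\sigma$; fully supported means every nonempty open set has positive measure. Gibbs relation: $\mathfrak{T}_X=\{(x,y)\in X\times X : x_n=y_n \text{ for all } n \text{ with } |n|>N, \text{ for some } N\ge 1\}$. A holonomy of $\mathfrak{T}_X$ is a Borel isomorphism $\psi\colon A\to B$ between Borel sets $A,B\subseteq X$ with $(x,\psi(x))\in\mathfrak{T}_X$ for all $x\in A$. A measure $\mu$ is $\mathfrak{T}_X$-nonsingular if for every Borel $A$ with $\mu(A)=0$, the saturation $\mathfrak{T}_X(A)=\{x' : \exists x\in A,\ (x,x')\in\mathfrak{T}_X\}$ has $\mu(\mathfrak{T}_X(A))=0$. An (additive) cocycle is a Borel function $\phi\colon\mathfrak{T}_X\to\mathbb{R}$ with $\phi(x,y)+\phi(y,z)=\phi(x,z)$ whenever $(x,y),(y,z)\in\mathfrak{T}_X$. A measure $\mu$ on $X$ is Gibbs with respect to $\phi$ if it is $\mathfrak{T}_X$-nonsingular and for every holonomy $\psi\colon A\to B$ of $\mathfrak{T}_X$, $\frac{d(\mu\circ\psi)}{d\mu}(x)=\exp(\phi(x,\psi(x)))$ for $\mu$-a.e. $x\in A$, where $(\mu\circ\psi)(E)=\mu(\psi(E))$ for Borel $E\subseteq A$. Since $\phi\circ(\pi^{-1}\times\pi^{-1})$ is only defined almost everywhere, the assertion that $\nu$ is Gibbs with respect to it means: $\nu$ is $\mathfrak{T}_Y$-nonsingular and for every holonomy $\psi\colon A\to B$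 of $\mathfrak{T}_Y$, for $\nu$-a.e. $y\in A$ the points $y,\psi(y)$ are doubly transitive, $(\pi^{-1}(y),\pi^{-1}(\psi(y)))\in\mathfrak{T}_X$, and $\frac{d(\nu\circ\psi)}{d\nu}(y)=\exp\big(\phi(\pi^{-1}(y),\pi^{-1}(\psi(y)))\big)$. *)

(* Defs.v *)
From HB Require Import structures.
From mathcomp Require Import all_boot all_order all_algebra.
From mathcomp Require Import all_classical all_reals all_analysis.

Set Implicit Arguments.
Unset Strict Implicit.
Unset Printing Implicit Defensive.

Import Order.TTheory GRing.Theory Num.Theory.
Import numFieldNormedType.Exports.

Local Open Scope classical_set_scope.
Local Open Scope ring_scope.

(* Measurable types are pointed in the library, so an alphabet carrying
   measures is a finite type with a distinguished letter. *)
#[short(type="pointedFinType")]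
HB.structure Definition PointedFinite := {T of Pointed T & Finite T}.

Definition full_shift (A : finType) : Type :=
  prod_topology (fun _ : int => discrete_topology A).

HB.instance Definition _ (A : finType) := Topological.on (full_shift A).
HB.instance Definition _ (A : pointedFinType) :=
  isPointed.Build (full_shift A) (fun=> point).

HB.instance Definition _ (A : pointedFinType) :=
  Measurable.copy (full_shift A) (g_sigma_algebraType (@open (full_shift A))).

Section shift_spaces.
Context (A : finType).
Implicit Types (X : set (full_shift A)) (x y : full_shift A) (u v w : seq A).

Definition left_shift x : full_shift A := fun n => x (n + 1).

Definition shift_space X := closed X /\ left_shift @` X = X.

Definition appears_at w x (n : int) : Prop :=
  [seq x (n + k%:Z) | k <- iota 0 (size w)] = w.

Definition language X : set (seq A) :=
  [set w | exists2 x, X x & exists n, appears_at w x n].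

Definition shift_of_finite_type X := exists F : seq (seq A),
  X = [set x | forall w, w \in F -> forall n, ~ appears_at w x n].

Definition irreducible_shift X := forall u v, language X u -> language X v ->
  exists2 w, language X w & language X (u ++ w ++ v).

Definition doubly_transitive X x := X x /\
  forall w, language X w -> forall N : nat,
    (exists2 n : int, n <= - N%:Z & appears_at w x n) /\
    (exists2 n : int, N%:Z <= n & appears_at w x n).

Definition gibbs_relation X : set (full_shift A * full_shift A) :=
  [set xy | [/\ X xy.1, X xy.2 & exists2 N : nat, (1 <= N)%N &
    forall n : int, N%:Z < `|n| -> xy.1 n = xy.2 n]].

Definition saturation X (E : set (full_shift A)) : set (full_shift A) :=
  [set x' | exists2 x, E x & gibbs_relation X (x, x')].

End shift_spaces.

Section codes.
Context (A B : finType).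
Implicit Types (X : set (full_shift A)) (Y : set (full_shift B)).
Implicit Types (pi : full_shift A -> full_shift B).

(* Only the restriction of [pi] to [X] is meaningful. *)
Definition factor_code X Y pi :=
  [/\ shift_space X, shift_space Y, {within X, continuous pi}, pi @` X = Y &
      forall x, X x -> pi (left_shift x) = left_shift (pi x)].

Definition almost_invertible X Y pi := forall y, doubly_transitive Y y ->
  exists! x, X x /\ pi x = y.

End codes.

Definition sofic (B : finType) (Y : set (full_shift B)) :=
  shift_space Y /\ exists (C : finType) (Z : set (full_shift C))
    (rho : full_shift C -> full_shift B),
    shift_of_finite_type Z /\ factor_code Z Y rho.

Definition borel_isomorphism d (T : measurableType d) (E F : set T)
    (psi : T -> T) :=
  [/\ measurable E, measurable F, set_bij E F psi, measurable_fun E psi &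
      forall G, measurable G -> G `<=` E -> measurable (psi @` G)].

Section transported_measure.
Local Open Scope ereal_scope.
Context d (T : measurableType d) (R : realType).
Context (mu : {finite_measure set T -> \bar R}) (E F : set T) (psi : T -> T).
Context (iso : borel_isomorphism E F psi).

(* The measure mu o psi on [E], extended by 0 outside of [E]. *)
Definition transport_measure (_ : borel_isomorphism E F psi) :
  set T -> \bar R := fun G => mu (psi @` (E `&` G)).

Local Notation mupsi := (transport_measure iso).

Let measurable_image G : measurable G -> measurable (psi @` (E `&` G)).
Proof.
case: iso => mE _ _ _ mpsi mG.
by apply: mpsi; [exact: measurableI|exact: subIsetl].
Qed.

Let transport0 : mupsi set0 = 0.
Proof. by rewrite /transport_measure setI0 image_set0 measure0. Qed.

Let transport_ge0 G : 0 <= mupsi G.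
Proof. exact: measure_ge0. Qed.

Let transport_sigma_additive : semi_sigma_additive mupsi.
Proof.
move=> G mG tG mUG; rewrite /transport_measure setI_bigcupr image_bigcup.
apply: measure_semi_sigma_additive.
- by move=> n; exact: measurable_image.
- case: iso => _ _ [_ psi_inj _] _ _.
  apply/trivIsetP => i j _ _ ij.
  apply/seteqP; split=> // _ [[x [Ex Gx] <-] [y [Ey Gy] yx]].
  have exy : y = x by apply: psi_inj; rewrite ?inE.
  have : (G i `&` G j) x by split=> //; rewrite -exy.
  by move/trivIsetP : tG => /(_ i j I I ij) ->.
- apply: bigcupT_measurable => n; exact: measurable_image.
Qed.

HB.instance Definition _ := isMeasure.Build _ _ _ mupsi
  transport0 transport_ge0 transport_sigma_additive.

Let transport_finite : fin_num_fun mupsi.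
Proof. by move=> G mG; apply: fin_num_measure; exact: measurable_image. Qed.

HB.instance Definition _ :=
  Measure_isFinite.Build _ _ _ mupsi transport_finite.

End transported_measure.

Section measures.
Context (R : realType) (A : pointedFinType).
Implicit Types (X : set (full_shift A)) (psi : full_shift A -> full_shift A).
Implicit Types (mu : probability (full_shift A) R).
Implicit Types (phi : full_shift A * full_shift A -> R).

(* A measure on the shift space [X] is a Borel probability measure [mu] on the
   ambient full shift with [mu X = 1]. *)

Definition fully_supported X mu := forall U : set (full_shift A),
  open U -> U `&` X !=set0 -> (0 < mu (U `&` X))%E.

Definition shift_invariant mu := forall E : set (full_shift A),
  measurable E -> mu (@left_shift A @^-1` E) = mu E.

Definition shift_ergodic mu := forall E : set (full_shift A),
  measurable E -> @left_shift A @^-1` E = E -> mu E = 0%E \/ mu E = 1%E.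

Definition gibbs_nonsingular X mu := forall E : set (full_shift A),
  measurable E -> E `<=` X -> mu E = 0%E -> mu (saturation X E) = 0%E.

Record holonomy X (E F : set (full_shift A)) psi : Prop := Holonomy {
  holonomy_dom : E `<=` X ;
  holonomy_cod : F `<=` X ;
  holonomy_iso : borel_isomorphism E F psi ;
  holonomy_rel : forall x, E x -> gibbs_relation X (x, psi x) }.

Definition holonomy_derivative X mu E F psi (h : holonomy X E F psi) :
    full_shift A -> \bar R :=
  Radon_Nikodym
    (charge_of_finite_measure (transport_measure mu (holonomy_iso h))) mu.

(* Only the restriction of [phi] to [gibbs_relation X] is meaningful. *)
Definition cocycle X phi := measurable_fun (gibbs_relation X) phi /\
  forall x y z, gibbs_relation X (x, y) -> gibbs_relation X (y, z) ->
    phi (x, y) + phi (y, z) = phi (x, z).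

Definition gibbs X mu phi := gibbs_nonsingular X mu /\
  forall E F psi (h : holonomy X E F psi),
    \forall x \ae mu, E x ->
      holonomy_derivative mu h x = (expR (phi (x, psi x)))%:E.

End measures.

Section factor_measures.
Context (R : realType) (A B : pointedFinType).
Implicit Types (X : set (full_shift A)) (Y : set (full_shift B)).
Implicit Types (pi : full_shift A -> full_shift B).
Implicit Types (mu : probability (full_shift A) R).
Implicit Types (nu : probability (full_shift B) R).

Definition is_pushforward X pi mu nu := forall E : set (full_shift B),
  measurable E -> nu E = mu (X `&` pi @^-1` E).

(* Some preimage of [y] in [X]; it is canonical only where it is unique, for
   instance at doubly transitive [y] when [pi] is almost invertible. *)
Definition code_inverse X pi (y : full_shift B) : full_shift A :=
  get [set x | X x /\ pi x = y].

(* [nu] is Gibbs with respect to phi o (pi^-1 x pi^-1), which is only defined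
   at pairs of doubly transitive points with related preimages. *)
Definition gibbs_factor X Y pi nu (phi : full_shift A * full_shift A -> R) :=
  gibbs_nonsingular Y nu /\
  forall E F psi (h : holonomy Y E F psi),
    \forall y \ae nu, E y ->
      let x := code_inverse X pi y in
      let x' := code_inverse X pi (psi y) in
      [/\ doubly_transitive Y y, doubly_transitive Y (psi y),
          gibbs_relation X (x, x') &
          holonomy_derivative nu h y = (expR (phi (x, x')))%:E].

End factor_measures.

(* Main.v *)
(* If y, y' are doubly transitive points of Y differing in finitely many
   coordinates, so do their preimages x, x'.  Indeed, by compactness a long central
   word of y already determines the central block of its unique preimage.  This
   word recurs in y and y' far to the left and far to the right, so x and x' agree
   on long blocks there; since X is of finite type, x and x' can be spliced along
   such a block, and the result is again a preimage of y, hence equal to x.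

   The same compactness makes the inverse of pi continuous on the doubly transitive
   points, a set of full measure: by ergodicity and full support every word recurs
   almost surely in both directions.  So pi is a Borel isomorphism modulo null sets
   under which saturations and holonomies of the Gibbs relation of Y lift to X, and
   Radon-Nikodym derivatives correspond. *)
From HB Require Import structures.
Require Import Defs.
From mathcomp Require Import all_boot all_order all_algebra.
From mathcomp Require Import all_classical all_reals all_analysis.
From mathcomp Require Import measurable_realfun zify.

Set Implicit Arguments.
Unset Strict Implicit.
Unset Printing Implicit Defensive.

Import Order.TTheory GRing.Theory Num.Theory.
Import numFieldNormedType.Exports.

Local Open Scope classical_set_scope.
Local Open Scope ring_scope.

(** * Topology of the full shift *)

Section full_shift_topology.
Context (A : finType).
Implicit Types (x y z : full_shift A) (m k : nat).

Definition agree m x z := forall n : int, (`|n| <= m)%N -> z n = x n.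

Lemma agreeW m k x z : (m <= k)%N -> agree k x z -> agree m x z.
Proof. by move=> mk h n nm; apply: h; exact: leq_trans mk. Qed.

Lemma nbhs_coordinate x (n : int) : nbhs x [set z : full_shift A | z n = x n].
Proof.
exact: (@proj_continuous int (fun=> discrete_topology A) n x _ (discrete_set1 _)).
Qed.

Lemma nbhs_agree x m : nbhs x [set z | agree m x z].
Proof.
have : \forall z \near x, forall i : 'I_(m + m).+1,
    z (i%:Z - m%:Z) = x (i%:Z - m%:Z).
  by apply: (@filter_forall _ _ _ _ (nbhs_filter x)) => i; exact: nbhs_coordinate.
apply: filterS => z h n nm.
have lt : (`|(n + m%:Z)%R| < (m + m).+1)%N by lia.
have := h (Ordinal lt) => /=.
by have -> : `|(n + m%:Z)%R|%:Z - m%:Z = n by lia.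
Qed.

Lemma nbhs_full_shiftP x (U : set (full_shift A)) :
  nbhs x U <-> exists m, [set z | agree m x z] `<=` U.
Proof.
split=> [xU|[m mU]]; last exact: filterS (nbhs_agree x m).
pose F := filter_from [set: nat] (fun m => [set z | agree m x z]).
have FF : Filter F.
  apply: filter_from_filter; first by exists 0%N.
  move=> i j _ _; exists (maxn i j) => // z /= h.
  by split; apply: agreeW h; rewrite ?leq_maxl ?leq_maxr.
(* The product topology is the supremum of the topologies induced by the coordinates, so convergence
   of [F] is checked one coordinate [i] at a time, where the window of radius [|i|] suffices. *)
suff /(_ U xU)[m _ mU] : F --> x by exists m.
apply/cvg_sup => i V /=.
rewrite (@nbhsE (initial_topology (@proj int (fun=> discrete_topology A) i))).
move=> [_ [[W oW <-] xW] WV].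
exists `|i|%N => // z /(_ i (leqnn _)) zi; apply: WV.
by rewrite /= /proj zi.
Qed.

Lemma compact_full_shift : compact [set: full_shift A].
Proof.
have -> : [set: full_shift A] =
    [set f : forall i : int, discrete_topology A |
      forall i, [set: discrete_topology A] (f i)].
  by apply/seteqP; split.
apply: (@tychonoff int (fun=> discrete_topology A) (fun=> setT)) => i.
by apply: (@finite_compact (discrete_topology A)); exact: (@finite_finset A).
Qed.

Lemma closed_compact (X : set (full_shift A)) : closed X -> compact X.
Proof. by move=> cX; apply: (subclosed_compact cX compact_full_shift). Qed.

End full_shift_topology.
(** * Words, sliding block codes and magic words *)

Section words.
Context (A : finType).
Implicit Types (X : set (full_shift A)) (x y z : full_shift A) (w : seq A).

(** The left side of [appears_at] with the length freed from any given word, so that words can be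
    read off points. *)
Definition window x (n : int) (l : nat) : seq A :=
  [seq x (n + k%:Z) | k <- iota 0 l].

Lemma appears_at_window x z n p l :
  appears_at (window x n l) z p <->
  forall k, (k < l)%N -> z (p + k%:Z) = x (n + k%:Z).
Proof.
rewrite /appears_at /window size_map size_iota; split.
  by move=> /eq_in_map h k kl; apply: h; rewrite mem_iota.
by move=> h; apply/eq_in_map => k; rewrite mem_iota => /h.
Qed.

Lemma appears_at_congr w x z n p :
  (forall k, (k < size w)%N -> z (p + k%:Z) = x (n + k%:Z)) ->
  appears_at w x n -> appears_at w z p.
Proof.
by move=> h <-; apply/appears_at_window.
Qed.

Lemma open_cylinder w n : open [set x : full_shift A | appears_at w x n].
Proof.
rewrite openE => x /= wx; apply/nbhs_full_shiftP.
exists (`|n| + size w)%N => z xz /=; apply: appears_at_congr wx => k kw.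
by rewrite xz//; lia.
Qed.

Lemma language_window X x n l : X x -> language X (window x n l).
Proof. by move=> Xx; exists x => //; exists n; apply/appears_at_window. Qed.

Definition shift_by (k : int) x : full_shift A := fun n => x (n + k).

Lemma shift_by_shift_space X k x : shift_space X -> X x -> X (shift_by k x).
Proof.
move=> [_ sX] Xx; elim/int_rect: k => [|k|k].
- by rewrite (_ : shift_by 0 x = x)//; apply/funext => n; rewrite /shift_by addr0.
- move=> Xk; rewrite -sX; exists (shift_by k x) => //.
  by apply/funext => n; rewrite /left_shift /shift_by; congr (x _); lia.
(* Invariance is the equality of [X] with its image; surjectivity of the shift on [X] supplies the
   step backwards. *)
- rewrite -{1}sX => -[z Xz zx]; rewrite (_ : shift_by _ x = z)//.
  apply/funext => n; have /(congr1 (fun f => f (n - 1))) := zx.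
  rewrite /left_shift /shift_by subrK => ->; congr (x _); lia.
Qed.

Lemma shift_space_left_shiftV X x : shift_space X -> X (left_shift x) -> X x.
Proof.
move=> sX /(shift_by_shift_space (-1) sX); rewrite (_ : shift_by _ _ = x)//.
by apply/funext => n; rewrite /shift_by /left_shift subrK.
Qed.

Lemma doubly_transitive_gibbs X x z : gibbs_relation X (x, z) ->
  doubly_transitive X x -> doubly_transitive X z.
Proof.
move=> [/= _ Xz [N _ xz]] [_ dx]; split=> // w lw M.
(* Occurrences this far out avoid [[-N, N]] over their whole length, so they survive in [z]. *)
have [[n nM wn] [p pM wp]] := dx w lw (M + N + size w).+1.
split; [exists n|exists p]; rewrite ?ltEint; try lia.
  by apply: appears_at_congr wn => k kw; rewrite xz//; lia.
by apply: appears_at_congr wp => k kw; rewrite xz//; lia.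
Qed.

Lemma gibbs_relation_sym X x z :
  gibbs_relation X (x, z) -> gibbs_relation X (z, x).
Proof. by move=> [? ? [N N1 xz]]; split=> //; exists N => // n /xz. Qed.

Definition splice (n : int) x z : full_shift A :=
  fun i => if i < n then x i else z i.

(** With [m] the greatest length of a forbidden word, an occurrence starting at or after [n - m] can
    be read in [z], by the agreement near [n], and an earlier one ends before [n] and lies in
    [x]. *)
Lemma splice_finite_type X : shift_of_finite_type X -> exists m : nat,
  forall x z n, X x -> X z ->
  (forall k : int, (`|k| <= m)%N -> z (n + k) = x (n + k)) ->
  X (splice n x z).
Proof.
move=> [F XF]; exists (\max_(w <- F) size w)%N => x z n.
rewrite XF /= => Xx Xz xz w wF p wp.
have wm : (size w <= \max_(w <- F) size w)%N by by rewrite (big_rem w)//= leq_maxl.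
move: (\max_(w <- F) size w)%N xz wm => m xz wm.
have [pn|pn] := leP (n - m%:Z) p.
  apply: (Xz w wF p); apply: appears_at_congr wp => k kw; rewrite /splice.
  case: ifPn => // pkn; have := xz (p + k%:Z - n); rewrite subrKC; apply.
  lia.
apply: (Xx w wF p); apply: appears_at_congr wp => k kw; rewrite /splice.
by rewrite ifT//; lia.
Qed.

Definition overwrite a0 (N : nat) (p : seq A) x : full_shift A :=
  fun n => if (`|n| <= N)%N then nth a0 p `|(n + N%:Z)%R|%N else x n.

(** Related points differ by rewriting one finite central window. The saturation thus becomes a
    countable union of preimages under continuous maps, which is what makes it Borel. *)
Lemma saturation_overwrite a0 X E : saturation X E =
  X `&` \bigcup_N \bigcup_p (overwrite a0 N p @^-1` (E `&` X)).
Proof.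
apply/seteqP; split=> [z [x Ex [/= Xx Xz [N _ xz]]]|z [Xz [N _ [p _ [Ep Xp]]]]].
  split=> //; exists N => //; exists (window x (- N%:Z) (N + N).+1) => //=.
  rewrite (_ : overwrite _ _ _ _ = x)//; apply/funext => n; rewrite /overwrite.
  case: ifPn => [nN|]; last by rewrite -ltnNge => nN; rewrite xz//; lia.
  rewrite (nth_map 0%N) ?size_iota ?nth_iota; [|lia..].
  by congr (x _); lia.
(* The successor is taken because [gibbs_relation] asks for a bound of at least 1. *)
exists (overwrite a0 N p z) => //; split=> //=; exists N.+1 => // n nN.
by rewrite /overwrite ifF//; lia.
Qed.

End words.

(** * Compactness arguments for codes *)

Section uniformity.
Context (A B : finType).
Implicit Types (X : set (full_shift A)) (Y : set (full_shift B)).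
Implicit Types (pi : full_shift A -> full_shift B).

(** Compactness in near-covering form, along the filter of large [k]: a property that holds for all
    large [k] locally at each point of [X] holds on all of [X] for a single [k]. *)
Lemma closed_uniform X (P : nat -> full_shift A -> Prop) : closed X ->
  (forall x, X x -> exists m, forall k z, (m <= k)%N -> X z -> agree m x z ->
    P k z) ->
  exists k, forall z, X z -> P k z.
Proof.
move=> /closed_compact /compact_near_coveringP/near_covering_withinP cX XP.
have /(_ _)[x Xx|k _ kP] := cX _ \oo P _.
  have [m mP] := XP x Xx.
  exists ([set z | agree m x z], [set k | (m <= k)%N]) => /=.
    by split; [exact: nbhs_agree|exists m].
  by move=> [z k] /= [xz mk] Xz; exact: mP.
by exists k => z; apply: (kP k) => /=.
Qed.

Lemma within_continuous_agreeP X pi : {within X, continuous pi} <->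
  forall x m, X x -> exists k, forall z, X z -> agree k x z ->
    agree m (pi x) (pi z).
Proof.
rewrite subspace_continuousP; split=> [cpi x m Xx|h x Xx U].
  have /= := cpi x Xx _ (nbhs_agree (pi x) m).
  rewrite nbhs_simpl /= /within /= => /nbhs_full_shiftP[k kX].
  by exists k => z Xz xz; exact: kX.
move=> /nbhs_full_shiftP[m mU]; rewrite nbhs_simpl /= /within /=.
apply/nbhs_full_shiftP; have [k kX] := h x m Xx.
by exists k => z xz Xz; apply: mU; exact: kX.
Qed.

Section code.
Context X Y pi (piXY : factor_code X Y pi).

Lemma factor_code_dom x : X x -> Y (pi x).
Proof. by case: piXY => _ _ _ <- _ Xx; exists x. Qed.

Lemma factor_code_shift_by k x : X x -> pi (shift_by k x) = shift_by k (pi x).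
Proof.
case: piXY => sX _ _ _ pis Xx.
have shiftS C (p : int) (z : full_shift C) :
    left_shift (shift_by p z) = shift_by (p + 1) z.
  by apply/funext => n; rewrite /left_shift /shift_by; congr (z _); lia.
elim/int_rect: k => [|k|k].
- have shift0 C (z : full_shift C) : shift_by 0 z = z.
    by apply/funext => n; rewrite /shift_by addr0.
  by rewrite !shift0.
- move=> IH; rewrite (_ : k.+1%:Z = k%:Z + 1) -?shiftS; last by lia.
  by rewrite pis ?IH ?shiftS//; exact: shift_by_shift_space.
- move=> IH; have Xk : X (shift_by (- k.+1%:Z) x) by exact: shift_by_shift_space.
  have := pis _ Xk; rewrite (_ : left_shift _ = shift_by (- k%:Z) x).
    rewrite IH => E; apply/funext => n.
    have /(congr1 (fun f => f (n - 1))) := E.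
    rewrite /left_shift /shift_by subrK => <-; congr (pi x _); lia.
  by apply/funext => n; rewrite /left_shift /shift_by; congr (x _); lia.
Qed.

(* Curtis-Hedlund-Lyndon. *)
Lemma factor_code_radius : exists r : nat, forall x z n, X x -> X z ->
  (forall k : int, (`|k| <= r)%N -> z (n + k) = x (n + k)) -> pi z n = pi x n.
Proof.
have [[cX _] _ /within_continuous_agreeP cpi _ _] := piXY.
have [r rP] : exists r, forall x, X x -> forall z, X z -> agree r x z ->
    pi z 0 = pi x 0.
  apply: closed_uniform => // x Xx; have [m mP] := cpi x 0%N Xx.
  exists m => k z mk Xz xz u Xu zu.
  rewrite (mP u Xu _ 0)// ?(mP z Xz _ 0)// => n nm.
  by rewrite zu ?xz//; exact: leq_trans mk.
exists r => x z n Xx Xz xz.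
have [sX _ _ _ _] := piXY.
have := rP _ (shift_by_shift_space n sX Xx) _ (shift_by_shift_space n sX Xz).
rewrite !factor_code_shift_by// /shift_by add0r; apply => k kr.
by rewrite addrC xz.
Qed.

(** Near [x] the conclusion holds outright. Any other point of [X] has an image differing from [y]
    at some coordinate, and so, by continuity, do its neighbours, where the premise fails once the
    window reaches that coordinate. Compactness makes the window uniform. *)
Lemma unique_preimage_window x y m : X x ->
  (forall z, X z -> pi z = y -> z = x) ->
  exists M, forall z, X z -> agree M y (pi z) -> agree m x z.
Proof.
move=> Xx xuniq; have [[cX _] _ /within_continuous_agreeP cpi _ _] := piXY.
apply: closed_uniform => // z Xz.
have [zx|zx] := pselect (z = x).
  by exists m => k u mk Xu zu _; rewrite -zx.
have [i yi] : exists i, pi z i <> y i.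
  apply/not_existsP => h; apply: zx; apply: xuniq => //; apply/funext => i.
  exact: contrapT (h i).
have [k kP] := cpi z `|i|%N Xz.
exists (maxn k `|i|%N) => l u kl Xu zu yu; exfalso; apply: yi.
rewrite -(kP u Xu _ i)//; last first.
  by apply: agreeW zu; rewrite leq_maxl.
by apply: yu; apply: leq_trans kl; rewrite leq_maxr.
Qed.

End code.
End uniformity.

Section magic_words.
Context (A B : finType) (X : set (full_shift A)) (Y : set (full_shift B)).
Context (pi : full_shift A -> full_shift B).
Context (X_finite_type : shift_of_finite_type X) (piXY : factor_code X Y pi).

(* Some word of [pi x] on [-M, M] determines preimages on [-m, m].  It recurs in
   [pi x], hence in [pi x'], far to the left and to the right; splicing [x] and
   [x'] there yields another preimage of [pi x], which must be [x]. *)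
Lemma gibbs_relation_preimage x x' : X x -> X x' ->
  (forall z, X z -> pi z = pi x -> z = x) ->
  doubly_transitive Y (pi x) -> gibbs_relation Y (pi x, pi x') ->
  gibbs_relation X (x, x').
Proof.
move=> Xx Xx' xuniq [_ dy] [/= Yy Yy' [N _ yy']].
have [sX _ _ _ _] := piXY.
have [m0 m0P] := splice_finite_type X_finite_type.
have [r rP] := factor_code_radius piXY.
(* Agreement on [m] coordinates around a seam serves both purposes: the splice stays in [X], and the
   local rule of [pi] sees only one of the two points. *)
pose m := maxn m0 r.
have [M MP] := unique_preimage_window piXY m Xx xuniq.
pose w := window (pi x) (- M%:Z) (M + M).+1.
have lw : language Y w by exact: language_window.
(* An occurrence of [w] at [p] is centred at [p + M]. If [pi x'] shows it too, both [x] and [x']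
   carry there the central block of [x]. *)
have occ p : appears_at w (pi x) p ->
    (forall i : int, (`|i| <= M)%N -> pi x' (p + M%:Z + i) = pi x (p + M%:Z + i)) ->
    forall i : int, (`|i| <= m)%N -> x' (p + M%:Z + i) = x (p + M%:Z + i).
  move=> /appears_at_window wp yp i im.
  have shiftx z : X z ->
      (forall i : int, (`|i| <= M)%N -> pi z (p + M%:Z + i) = pi x i) ->
      z (p + M%:Z + i) = x i.
    move=> Xz zx; rewrite [_ + i]addrC.
    apply: (MP _ (shift_by_shift_space (p + M%:Z) sX Xz)) => // j jM.
    by rewrite (factor_code_shift_by piXY)// /shift_by addrC zx.
  have xp (j : int) : (`|j| <= M)%N -> pi x (p + M%:Z + j) = pi x j.
    move=> jM; have := wp `|(j + M%:Z)%R|%N.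
    have -> : p + `|(j + M%:Z)%R|%:Z = p + M%:Z + j by lia.
    have -> : - M%:Z + `|(j + M%:Z)%R|%:Z = j by lia.
    by apply; lia.
  by rewrite !shiftx// => j jM; rewrite yp// xp.
have spl (n : int) u v : X u -> X v ->
    (forall i : int, (`|i| <= m)%N -> v (n + i) = u (n + i)) ->
    (forall i : int, i <= n -> pi u i = pi x i) ->
    (forall i : int, n <= i -> pi v i = pi x i) -> splice n u v = x.
  move=> Xu Xv uv uy vy.
  have Xs : X (splice n u v).
    by apply: m0P => // k km; apply: uv; rewrite leq_max km.
  apply: xuniq => //; apply/funext => i.
  have [ni|ni] := leP n i.
    rewrite -vy//; apply: rP => // k kr; rewrite /splice; case: ifPn => // ikn.
    have := uv (i + k - n); rewrite subrKC => ->//.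
    by rewrite leq_max; lia.
  rewrite -uy ?(ltW ni)//; apply: rP => // k kr; rewrite /splice; case: ifPn => // ikn.
  have := uv (i + k - n); rewrite subrKC => ->//.
  by rewrite leq_max; lia.
(* The word [w] has length [2M + 1], so these occurrences lie wholly outside [[-N, N]], where [pi x]
   and [pi x'] agree. *)
have [[p1 p1N wp1] [p2 p2N wp2]] := dy w lw (N + M + M).+1.
have far (i : int) : N%:Z < `|i| -> pi x' i = pi x i by move=> /yy'.
(* Taking [x'] to the left of the seam gives agreement with [x] there; [s2] does the same on the
   right. *)
have s1 : splice (p1 + M%:Z) x' x = x.
  apply: spl => // [i im|i ip]; last by apply: far; lia.
  apply/esym/occ => // j jM; apply: far; lia.
have s2 : splice (p2 + M%:Z) x x' = x.
  apply: spl => // [i im|i ip]; last by apply: far; lia.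
  apply/occ => // j jM; apply: far; lia.
split=> //=; exists (`|p1| + `|p2| + M).+1 => // i ni.
have [i0|i0] := leP 0 i.
  by rewrite -[in LHS]s2 /splice ifF//; apply/negbTE; lia.
by rewrite -[in LHS]s1 /splice ifT//; lia.
Qed.

End magic_words.
(** * Measurability *)

Section countable_operations.
Context d (T : measurableType d) (U : countType).

Lemma countable_bigcup_measurable (D : set U) (F : U -> set T) :
  (forall i, D i -> measurable (F i)) -> measurable (\bigcup_(i in D) F i).
Proof.
move=> mF; rewrite bigcup_mkcond; apply: countable_bigcupT_measurable => // i.
by case: ifPn => // /set_mem; exact: mF.
Qed.

Lemma countable_bigcap_measurable (D : set U) (F : U -> set T) :
  (forall i, D i -> measurable (F i)) -> measurable (\bigcap_(i in D) F i).
Proof.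
move=> mF; rewrite -[X in measurable X]setCK setC_bigcap; apply: measurableC.
by apply: countable_bigcup_measurable => i Di; apply: measurableC; exact: mF.
Qed.

End countable_operations.

Section measurability.
Context (A : pointedFinType).
Implicit Types (X E D : set (full_shift A)) (x z : full_shift A) (w : seq A).

Lemma open_measurable_full_shift E : open E -> measurable E.
Proof. exact: sub_sigma_algebra. Qed.

Lemma closed_measurable_full_shift E : closed E -> measurable E.
Proof.
by move=> /closed_openC/open_measurable_full_shift/measurableC; rewrite setCK.
Qed.

Lemma measurable_cylinder w n :
  measurable [set x : full_shift A | appears_at w x n].
Proof. by apply: open_measurable_full_shift; exact: open_cylinder. Qed.

Lemma measurable_appears_in w (J : set int) :
  measurable [set x : full_shift A | exists2 n, J n & appears_at w x n].
Proof.
rewrite (_ : [set x | _] =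
    \bigcup_(n in J) [set x : full_shift A | appears_at w x n]).
  by apply: countable_bigcup_measurable => n _; exact: measurable_cylinder.
by apply/seteqP; split => x [n Jn wn]; exists n.
Qed.

Lemma measurable_doubly_transitive X : closed X ->
  measurable [set x | doubly_transitive X x].
Proof.
move=> cX; rewrite (_ : [set x | _] = X `&` \bigcap_(w in language X) \bigcap_N
    ([set x : full_shift A | exists2 n : int, n <= - N%:Z & appears_at w x n] `&`
     [set x : full_shift A | exists2 n : int, N%:Z <= n & appears_at w x n])).
  apply: measurableI; first exact: closed_measurable_full_shift.
  apply: countable_bigcap_measurable => // w _.
  apply: bigcapT_measurable => N; apply: measurableI.
    exact: (measurable_appears_in w [set n : int | n <= - N%:Z]).
  exact: (measurable_appears_in w [set n : int | N%:Z <= n]).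
apply/seteqP; split=> x [Xx dx]; split=> //.
  by move=> w lw N _; exact: dx.
by move=> w lw N; exact: (dx w lw N I).
Qed.

Lemma measurable_fun_within_continuous (B : pointedFinType) D
    (f : full_shift A -> full_shift B) :
  measurable D -> {within D, continuous f} -> measurable_fun D f.
Proof.
move=> mD cf; apply: (measurability (@open (full_shift B)) erefl).
move=> _ [U oU <-]; have /continuousP/(_ U oU) := cf.
move=> /open_subspaceP[V oV]; rewrite setIC => VD.
by rewrite setIC -VD setIC; apply: measurableI => //; exact: open_measurable_full_shift.
Qed.

Lemma measurable_overwrite a0 N p : measurable_fun setT (@overwrite A a0 N p).
Proof.
apply: measurable_fun_within_continuous => //.
apply/within_continuous_agreeP => x m _; exists m => z _ xz n nm.
by rewrite /overwrite; case: ifP => // _; exact: xz.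
Qed.

Lemma measurable_saturation X E : closed X -> measurable E ->
  measurable (saturation X E).
Proof.
move=> /closed_measurable_full_shift mX mE.
rewrite (saturation_overwrite point); apply: measurableI => //.
apply: bigcupT_measurable => N; apply: countable_bigcupT_measurable => // p.
rewrite -[X in measurable X]setTI; apply: measurable_overwrite => //.
exact: measurableI.
Qed.

End measurability.
(** * Radon-Nikodym derivatives under an isomorphism modulo null sets *)

Section null_sets.
Context d (T : measurableType d) (R : realType) (mu : {measure set T -> \bar R}).

Lemma eq_measure_setD (N E F : set T) : measurable N -> measurable E ->
  measurable F -> mu N = 0%E -> E `\` N = F `\` N -> mu E = mu F.
Proof.
move=> mN mE mF N0 EF; have null G : measurable G -> mu (G `&` N) = 0%E.
  move=> mG; apply: (subset_measure0 _ mN _ N0) => //; exact: measurableI.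
rewrite (measureDI mu mE mN) (measureDI mu mF mN) EF.
by congr (_ + _)%E; apply: etrans (null E mE) (esym (null F mF)).
Qed.

Lemma aeP (P : T -> Prop) : (\forall x \ae mu, P x) ->
  exists N, [/\ measurable N, mu N = 0%E & forall x, ~ N x -> P x].
Proof.
move=> [N [mN N0 PN]]; exists N; split=> // x Nx.
by apply: contrapT => Px; apply: Nx; exact: PN.
Qed.

End null_sets.

Section radon_nikodym_transfer.
Local Open Scope ereal_scope.
Context d d' (T : measurableType d) (S : measurableType d') (R : realType).
Context (mu : {finite_measure set T -> \bar R}).
Context (nu : {finite_measure set S -> \bar R}).
Context (mu' : {charge set T -> \bar R}) (nu' : {charge set S -> \bar R}).
Context (p : {mfun T >-> S}) (q : S -> T) (mq : measurable_fun setT q).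
Context (nuE : forall G, measurable G -> nu G = mu (p @^-1` G)).
Context (nu'E : forall G, measurable G -> nu' G = mu' (p @^-1` G)).
Context (qpK : \forall x \ae mu, q (p x) = x).
Context (mu_dom : mu' `<< mu) (nu_dom : nu' `<< nu).

Let integral_pullback (D : set S) (f : S -> \bar R) : measurable D ->
  nu.-integrable setT f ->
  mu.-integrable (p @^-1` D) (f \o p) /\
  \int[nu]_(y in D) f y = \int[mu]_(x in p @^-1` D) (f \o p) x.
Proof.
move=> mD fi; have mf := measurable_int _ fi.
have mp := measurable_funPT p.
have mpD : measurable (p @^-1` D) by rewrite -[X in measurable X]setTI; exact: mp.
have eqI (g : S -> \bar R) (C : set S) : measurable C ->
    \int[nu]_(y in C) g y = \int[pushforward mu p]_(y in C) g y.
  by move=> mC; apply: eq_measure_integral => G mG _; exact: nuE.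
have fpi : mu.-integrable setT (f \o p).
  apply/integrableP; split; first exact: measurableT_comp.
  rewrite -[X in \int[mu]_(x in X) _](@preimage_setT _ _ p).
  rewrite -(@ge0_integral_pushforward _ _ _ _ _ _ mp mu setT (fun y => `|f y|))//.
  - by rewrite -eqI//; case/integrableP : fi.
  - exact: measurableT_comp.
have fpiD : mu.-integrable (p @^-1` D) (f \o p) by exact: integrableS fpi.
by split=> //; rewrite eqI// integral_pushforward.
Qed.

Lemma Radon_Nikodym_transfer :
  \forall x \ae mu, Radon_Nikodym nu' nu (p x) = Radon_Nikodym mu' mu x.
Proof.
set f := Radon_Nikodym nu' nu; set g := Radon_Nikodym mu' mu.
have fi : nu.-integrable setT f by exact: Radon_Nikodym_integrable.
have gi : mu.-integrable setT g by exact: Radon_Nikodym_integrable.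
have [fpi _] := integral_pullback measurableT fi.
rewrite preimage_setT in fpi.
have [N [mN N0 NP]] := aeP qpK.
have mp := measurable_funPT p.
have : ae_eq mu setT g (f \o p).
  apply: integral_ae_eq => //; first exact: measurable_int fpi.
  move=> E _ mE.
  have mqE : measurable (q @^-1` E) by rewrite -[X in measurable X]setTI; exact: mq.
  have mpqE : measurable (p @^-1` (q @^-1` E)).
    by rewrite -[X in measurable X]setTI; exact: mp.
  have EN : E `\` N = (p @^-1` (q @^-1` E)) `\` N.
    by apply/seteqP; split=> x /= [Ex Nx]; split=> //; move: Ex; rewrite NP.
  have int_eq (h : T -> \bar R) : mu.-integrable setT h ->
      \int[mu]_(x in E) h x = \int[mu]_(x in p @^-1` (q @^-1` E)) h x.
    move=> hi; rewrite (negligible_integral mN mE _ N0); last exact: integrableS hi.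
    by rewrite EN -(negligible_integral mN mpqE)//; exact: integrableS hi.
  rewrite int_eq// [RHS]int_eq// -Radon_Nikodym_integral// -nu'E//.
  by rewrite -(integral_pullback mqE fi).2 -Radon_Nikodym_integral.
by apply: filterS => x /= ->.
Qed.

End radon_nikodym_transfer.
(** * Recurrence and doubly transitive points *)

Section doubly_transitive_points.
Context (R : realType) (A : pointedFinType) (X : set (full_shift A)).
Context (mu : probability (full_shift A) R).
Context (X_shift : shift_space X) (mu_on_X : mu X = 1%E).
Context (mu_supp : fully_supported X mu) (mu_inv : shift_invariant mu).
Context (mu_erg : shift_ergodic mu).
Implicit Types (w : seq A).

Let mX : measurable X.
Proof. by apply: closed_measurable_full_shift; case: X_shift. Qed.

Lemma negligible_setC_full (E : set (full_shift A)) : measurable E ->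
  mu E = 1%E -> mu (~` E) = 0%E.
Proof. by move=> mE E1; rewrite probability_setC// E1 subee. Qed.

(** By continuity from above the intersection has the common measure of the [G N]. This is positive,
    so ergodicity makes it 1. *)
Lemma ergodic_bigcap (G : nat -> set (full_shift A)) :
  (forall N, measurable (G N)) ->
  (forall N M, (N <= M)%N -> G M `<=` G N) ->
  (forall N, mu (G N) = mu (G 0%N)) ->
  @left_shift A @^-1` (\bigcap_N G N) = \bigcap_N G N ->
  (0 < mu (G 0%N))%E -> \forall x \ae mu, forall N, G N x.
Proof.
move=> mG dG eG sG G0.
have mI : measurable (\bigcap_N G N) by exact: bigcapT_measurable.
have cvgG : mu \o G @ \oo --> mu (\bigcap_N G N).
  apply: nonincreasing_cvg_mu => //.
    by rewrite -ge0_fin_numE ?fin_num_measure.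
  by move=> N M /dG GM; apply/subsetPset.
have muI : mu (\bigcap_N G N) = mu (G 0%N).
  rewrite -(cvg_lim _ cvgG)// (_ : mu \o G = cst (mu (G 0%N))) ?lim_cst//.
  by apply/funext => N /=; exact: eG.
have [E|E] := mu_erg mI sG; first by move: G0; rewrite -muI E ltxx.
exists (~` \bigcap_N G N); split; first exact: measurableC.
  exact: negligible_setC_full.
by move=> x /= xG IG; apply: xG => N; exact: IG.
Qed.

(** Shifting an occurrence of [w] to the origin shows that its cylinder meets [X]; full support does
    the rest. *)
Let cylinder_measure_gt0 w (G : set (full_shift A)) : language X w ->
  measurable G -> [set x : full_shift A | appears_at w x 0] `<=` G ->
  (0 < mu G)%E.
Proof.
move=> [x Xx [n wn]] mG wG.
have wX : [set x : full_shift A | appears_at w x 0] `&` X !=set0.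
  exists (shift_by n x); split; last exact: shift_by_shift_space.
  apply: appears_at_congr wn => k _; rewrite /shift_by add0r addrC//.
apply: lt_le_trans (mu_supp (open_cylinder w 0) wX) _.
apply: le_measure; rewrite ?inE//.
  by apply: measurableI => //; exact: measurable_cylinder.
by move=> z [wz _]; exact: wG.
Qed.

Let appears_at_left_shift w x n :
  appears_at w (left_shift x) n <-> appears_at w x (n + 1).
Proof.
by split; apply: appears_at_congr => k _; rewrite /left_shift; congr (x _); lia.
Qed.

Lemma ae_recurrent_right w : language X w -> \forall x \ae mu, forall N : nat,
  exists2 n : int, N%:Z <= n & appears_at w x n.
Proof.
move=> lw; pose G (N : nat) :=
  [set x : full_shift A | exists2 n : int, N%:Z <= n & appears_at w x n].
have mG N : measurable (G N).
  exact: (measurable_appears_in w [set n : int | N%:Z <= n]).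
(* Shift invariance of [mu] thus gives all [G N] the same measure. *)
have GS N : @left_shift A @^-1` G N = G N.+1.
  apply/seteqP; split=> x /= [n nN wn].
    by exists (n + 1); [lia|exact/appears_at_left_shift].
  by exists (n - 1); [lia|apply/appears_at_left_shift; rewrite subrK].
have dG N M : (N <= M)%N -> G M `<=` G N.
  by move=> NM x [n nM wn]; exists n => //; lia.
apply: (@ergodic_bigcap G) => //.
- by elim=> // N <-; rewrite -GS mu_inv.
- rewrite preimage_bigcap; apply/seteqP; split=> x Gx N _.
    by apply: (dG N N.+1) => //; rewrite -GS; exact: Gx.
  by rewrite GS; exact: Gx.
- by apply: (cylinder_measure_gt0 lw) => // x wx; exists 0.
Qed.

Lemma ae_recurrent_left w : language X w -> \forall x \ae mu, forall N : nat,
  exists2 n : int, n <= - N%:Z & appears_at w x n.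
Proof.
move=> lw; pose G (N : nat) :=
  [set x : full_shift A | exists2 n : int, n <= - N%:Z & appears_at w x n].
have mG N : measurable (G N).
  exact: (measurable_appears_in w [set n : int | n <= - N%:Z]).
(* On the left the shift moves the bound the other way: the preimage lowers the index. *)
have GS N : @left_shift A @^-1` G N.+1 = G N.
  apply/seteqP; split=> x /= [n nN wn].
    by exists (n + 1); [lia|exact/appears_at_left_shift].
  by exists (n - 1); [lia|apply/appears_at_left_shift; rewrite subrK].
have dG N M : (N <= M)%N -> G M `<=` G N.
  by move=> NM x [n nM wn]; exists n => //; lia.
apply: (@ergodic_bigcap G) => //.
- by elim=> // N <-; rewrite -[in RHS]GS mu_inv.
- rewrite preimage_bigcap; apply/seteqP; split=> x Gx N _.
    by rewrite -GS; exact: Gx.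
  have : (@left_shift A @^-1` G N.+1) x by rewrite GS; exact: Gx.
  exact: dG.
- by apply: (cylinder_measure_gt0 lw) => // x wx; exists 0.
Qed.

Lemma ae_doubly_transitive : \forall x \ae mu, doubly_transitive X x.
Proof.
have aeX : \forall x \ae mu, X x.
  by exists (~` X); split => //; [exact: measurableC|exact: negligible_setC_full].
(* Words are enumerated by their codes, so that only countably many null sets are united. *)
have : \forall x \ae mu, forall i : nat, forall w, unpickle i = Some w ->
    language X w -> forall N : nat,
    (exists2 n : int, n <= - N%:Z & appears_at w x n) /\
    (exists2 n : int, N%:Z <= n & appears_at w x n).
  apply: ae_foralln => i; case: (unpickle i) => [w|]; last by apply: aeW.
  have [lw|lw] := pselect (language X w); last by apply: aeW => x _ [<-].
  apply: filterS2 (ae_recurrent_left lw) (ae_recurrent_right lw).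
  by move=> x l r _ [<-] _ N.
apply: filterS2 aeX => x Xx dx; split=> // w.
exact: (dx (pickle w) w (pickleK w)).
Qed.

End doubly_transitive_points.
(** * Lifting holonomies through an almost invertible code *)

(** A holonomy sends a null set into its saturation, which is null by nonsingularity. This absolute
    continuity is what entitles one to integrate the Radon-Nikodym derivative. *)
Lemma transport_measure_dominated (R : realType) (A : pointedFinType)
    (X E F : set (full_shift A)) (mu : probability (full_shift A) R) psi
    (h : holonomy X E F psi) : closed X -> gibbs_nonsingular X mu ->
  charge_of_finite_measure (transport_measure mu (holonomy_iso h)) `<< mu.
Proof.
move=> cX nonsing; apply/null_content_dominatesP => G mG G0.
have [EX _ [mE _ _ _ mpsi] rel] := h.
have mEG : measurable (E `&` G) by exact: measurableI.
have EG0 : mu (E `&` G) = 0%E by exact: (subset_measure0 mEG mG).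
have EGX : E `&` G `<=` X by move=> x [/EX].
apply: (subset_measure0 _ (measurable_saturation cX mEG) _ (nonsing _ mEG EGX EG0)).
  by apply: mpsi => // x [].
by move=> _ [x [Ex Gx] <-]; exists x => //; exact: rel.
Qed.

(** * The pushforward measure and the almost everywhere inverse of the code *)

Section factor_measure.
Context (R : realType) (A B : pointedFinType).
Context (X : set (full_shift A)) (Y : set (full_shift B)).
Context (pi : full_shift A -> full_shift B).
Context (mu : probability (full_shift A) R) (nu : probability (full_shift B) R).
Context (X_finite_type : shift_of_finite_type X).
Context (pi_factor : factor_code X Y pi) (pi_inv : almost_invertible X Y pi).
Context (mu_on_X : mu X = 1%E) (mu_supp : fully_supported X mu).
Context (mu_inv : shift_invariant mu) (mu_erg : shift_ergodic mu).
Context (mu_nonsing : gibbs_nonsingular X mu).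
Context (nu_def : is_pushforward X pi mu nu).

Let X_shift : shift_space X. Proof. by case: pi_factor. Qed.
Let Y_shift : shift_space Y. Proof. by case: pi_factor. Qed.
Let cX : closed X. Proof. by case: X_shift. Qed.
Let cY : closed Y. Proof. by case: Y_shift. Qed.
Let mX : measurable X. Proof. exact: closed_measurable_full_shift. Qed.
Let mY : measurable Y. Proof. exact: closed_measurable_full_shift. Qed.
Let piX x : X x -> Y (pi x). Proof. exact: (factor_code_dom pi_factor). Qed.

Let mpi : measurable_fun X pi.
Proof. by apply: measurable_fun_within_continuous => //; case: pi_factor. Qed.

Lemma pushforward_full : nu Y = 1%E.
Proof.
by rewrite nu_def// (_ : X `&` _ = X)//; apply/setIidPl => x /piX.
Qed.

Lemma pushforward_fully_supported : fully_supported Y nu.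
Proof.
have [_ _ cpi piXY _] := pi_factor; move=> U oU [y [Uy]].
rewrite -{1}piXY => -[x Xx xy].
have mU : measurable U by exact: open_measurable_full_shift.
rewrite nu_def; last exact: measurableI.
have /continuousP/(_ U oU)/open_subspaceP[V oV VU] := cpi.
have VX : V `&` X = (fun x => U (pi x)) `&` X := VU.
rewrite (_ : X `&` _ = V `&` X).
  by apply: mu_supp => //; exists x; rewrite VX; split=> //=; rewrite xy.
rewrite VX; apply/seteqP; split=> z [] => [Xz []|Uz Xz]; split=> //.
by split=> //; exact: piX.
Qed.

Lemma pushforward_shift_invariant : shift_invariant nu.
Proof.
have [_ _ _ _ pis] := pi_factor; move=> E mE.
have sm : measurable_fun setT (@left_shift B).
  apply: measurable_fun_within_continuous => //.
  apply/within_continuous_agreeP => x m _; exists m.+1 => z _ xz n nm.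
  by rewrite /left_shift xz//; lia.
have msE : measurable (@left_shift B @^-1` E).
  by rewrite -[X in measurable X]setTI; exact: sm.
rewrite !nu_def// -[RHS]mu_inv; last exact: mpi.
congr (mu _); apply/seteqP; split=> x /= [].
  move=> Xx; rewrite -pis// => Ex; split=> //.
  by case: X_shift => _ <-; exists x.
move=> /(shift_space_left_shiftV X_shift) Xx Ex.
by rewrite -pis.
Qed.

Lemma pushforward_ergodic : shift_ergodic nu.
Proof.
have [_ _ _ _ pis] := pi_factor; move=> E mE sE.
rewrite nu_def//; apply: mu_erg; first exact: mpi.
apply/seteqP; split=> x /= [Xx Ex].
  have Xx' := shift_space_left_shiftV X_shift Xx.
  by split=> //; rewrite -sE /= -pis.
split; first by case: X_shift => _ <-; exists x.
by move: Ex; rewrite -{1}sE /= -pis.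
Qed.

Lemma pushforward_ae_doubly_transitive : \forall y \ae nu, doubly_transitive Y y.
Proof.
apply: ae_doubly_transitive => //.
- exact: pushforward_full.
- exact: pushforward_fully_supported.
- exact: pushforward_shift_invariant.
- exact: pushforward_ergodic.
Qed.

Let DT : set (full_shift B) := [set y | doubly_transitive Y y].
Let c := code_inverse X pi.

Let mDT : measurable DT. Proof. exact: measurable_doubly_transitive. Qed.

Lemma code_inverseP y : doubly_transitive Y y ->
  X (code_inverse X pi y) /\ pi (code_inverse X pi y) = y.
Proof.
move=> [Yy _]; have [_ _ _ piXY _] := pi_factor.
apply: (@getPex _ [set x | X x /\ pi x = y]).
by move: Yy; rewrite -piXY => -[x Xx xy]; exists x.
Qed.

Lemma preimage_uniq x z : doubly_transitive Y (pi x) -> X x -> X z ->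
  pi z = pi x -> z = x.
Proof.
move=> /pi_inv[u [_ uP]] Xx Xz zx.
by rewrite -(uP z)// (uP x).
Qed.

Lemma code_inverseK x : X x -> doubly_transitive Y (pi x) ->
  code_inverse X pi (pi x) = x.
Proof. by move=> Xx dx; have [? ?] := code_inverseP dx; exact: preimage_uniq. Qed.

Lemma code_inverse_continuous :
  {within [set y | doubly_transitive Y y], continuous (code_inverse X pi)}.
Proof.
apply/within_continuous_agreeP => y m dy.
have [Xc pic] := code_inverseP dy.
have [|M MP] := unique_preimage_window pi_factor m (y := y) Xc.
  by move=> z Xz zy; apply: preimage_uniq; rewrite ?pic.
exists M => z dz yz; have [Xz piz] := code_inverseP dz.
by apply: MP => //; rewrite piz.
Qed.

Let mc : measurable_fun DT c.
Proof.
by apply: measurable_fun_within_continuous => //; exact: code_inverse_continuous.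
Qed.

(* [pi] and its inverse are only controlled on [X] and [DT]; these restrictions
   are measurable everywhere, as pushing integrals forward requires. *)
Let p := pi \_ X.
Let q := c \_ DT.

Let mp : measurable_fun setT p.
Proof. exact: (measurable_restrictT pi mX).1. Qed.

Let mq : measurable_fun setT q.
Proof. exact: (measurable_restrictT c mDT).1. Qed.


Let pE x : X x -> p x = pi x. Proof. by move=> Xx; rewrite /p patchE mem_set. Qed.
Let qE y : DT y -> q y = c y. Proof. by move=> dy; rewrite /q patchE mem_set. Qed.

(* Off this null set, [p] and [q] are mutually inverse. *)
Let N0 : set (full_shift A) := ~` (X `&` pi @^-1` DT).

Let mN0 : measurable N0. Proof. by apply: measurableC; exact: mpi. Qed.

Let muN0 : mu N0 = 0%E.
Proof.
apply: negligible_setC_full; first exact: mpi.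
rewrite -nu_def//; have [N [mN N0' NP]] := aeP pushforward_ae_doubly_transitive.
rewrite -(setCK DT) probability_setC ?(subset_measure0 _ mN _ N0') ?sube0//;
  try exact: measurableC.
by move=> y dy; apply: contrapT => /NP.
Qed.

Let notN0 x : ~ N0 x -> X x /\ DT (pi x).
Proof. by move=> /contrapT. Qed.

Let mpreim G : measurable G -> measurable (p @^-1` G).
Proof. by move=> mG; rewrite -[X in measurable X]setTI; exact: mp. Qed.

Let qpreim G : measurable G -> measurable (q @^-1` G).
Proof. by move=> mG; rewrite -[X in measurable X]setTI; exact: mq. Qed.

Let nuE G : measurable G -> nu G = mu (p @^-1` G).
Proof.
move=> mG; rewrite nu_def//; apply: (eq_measure_setD mN0) => //.
- exact: mpi.
- exact: mpreim.
apply/seteqP; split=> x /= [Gx Nx]; have [Xx _] := notN0 Nx; split=> //.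
  by rewrite pE//; case: Gx.
by split=> //; rewrite -pE.
Qed.

Let ae_qpK : \forall x \ae mu, q (p x) = x.
Proof.
exists N0; split=> // x /= qpx; apply: contrapT => /notN0[Xx dx].
by apply: qpx; rewrite pE// qE//; exact: code_inverseK.
Qed.

Let ae_code_inverse (P : full_shift A -> Prop) :
  (\forall x \ae mu, P x) -> \forall y \ae nu, DT y -> P (c y).
Proof.
move=> /aeP[N [mN muN NP]]; exists (q @^-1` N); split; first exact: qpreim.
  rewrite nuE; last exact: qpreim.
  rewrite -muN; apply: (eq_measure_setD mN0) => //.
    by apply: mpreim; exact: qpreim.
  apply/seteqP; split=> x /= [Nx N0x]; have [Xx dx] := notN0 N0x; split=> //;
    by move: Nx; rewrite pE// qE// [c _]code_inverseK.
move=> y /= /not_implyP[dy Pcy]; rewrite qE//; apply: contrapT => /NP.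
exact: Pcy.
Qed.

Lemma pushforward_nonsingular : gibbs_nonsingular Y nu.
Proof.
move=> E mE EY E0; have mS := measurable_saturation cY mE.
rewrite nu_def//; apply: measure_negligible; first exact: mpi.
have mE' : measurable (X `&` pi @^-1` E) by exact: mpi.
have E'X : X `&` pi @^-1` E `<=` X by exact: subIsetl.
(* Off [N0], a point over the saturation of [E] is related to the unique preimage of a point of [E],
   so the nonsingularity of [mu] applies. *)
apply: (@negligibleS _ _ _ mu (N0 `|` saturation X (X `&` pi @^-1` E))); last first.
  apply: negligibleU; first exact/negligibleP.
  apply/negligibleP; first exact: measurable_saturation.
  by apply: mu_nonsing => //; rewrite -nu_def.
move=> x [Xx [y Ey yx]].
have [|/notN0[_ dx]] := pselect (N0 x); first by left.
right; have dy := doubly_transitive_gibbs (gibbs_relation_sym yx) dx.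
have [Xc pic] := code_inverseP dy.
exists (c y); first by split=> //=; rewrite pic.
by apply: (gibbs_relation_preimage X_finite_type pi_factor); rewrite ?pic// => z Xz zy;
  apply: preimage_uniq; rewrite ?pic.
Qed.

(** * The lift of a single holonomy *)

Section lifted_holonomy.
Context (E F : set (full_shift B)) (psi : full_shift B -> full_shift B).
Context (h : holonomy Y E F psi).

Definition lift_dom (G : set (full_shift B)) := X `&` pi @^-1` (G `&` DT).
Definition lift_holonomy x := code_inverse X pi (psi (pi x)).

Let psi_DT y : E y -> DT y -> DT (psi y).
Proof. by move=> Ey; apply: doubly_transitive_gibbs; exact: (holonomy_rel h). Qed.

Let lift_holonomyP x : lift_dom E x ->
  X (lift_holonomy x) /\ pi (lift_holonomy x) = psi (pi x).
Proof. by move=> [Xx [Ex dx]]; apply: code_inverseP; exact: psi_DT. Qed.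

(** Writes images under the lift through images under [psi]. This yields both that images of Borel
    sets are Borel and the comparison of the transported measures. *)
Lemma lift_holonomy_image G : G `<=` lift_dom E ->
  lift_holonomy @` G = X `&` pi @^-1` (psi @` (DT `&` c @^-1` G)).
Proof.
move=> GE; apply/seteqP; split=> [_ [x Gx <-]|x [Xx [y [dy Gcy] yx]]].
  have [Xx [Ex dx]] := GE _ Gx; have [Xl pil] := lift_holonomyP (GE _ Gx).
  by split=> //=; exists (pi x) => //; split=> //=; rewrite [c _]code_inverseK.
have [Xc pic] := code_inverseP dy.
exists (c y) => //; rewrite /lift_holonomy pic yx; apply: code_inverseK => //.
by rewrite -yx; apply: psi_DT => //; have [_ []] := GE _ Gcy; rewrite pic.
Qed.

Lemma lift_borel_isomorphism :
  borel_isomorphism (lift_dom E) (lift_dom F) lift_holonomy.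
Proof.
have [_ _ [mE mF [psif psii psis] mpsi mpsiI] rel] := h.
have mlift G : measurable G -> measurable (lift_dom G).
  by move=> mG; apply: mpi => //; exact: measurableI.
split; [exact: mlift|exact: mlift| | |].
- split.
  + move=> x lx; have [Xx [Ex dx]] := lx; have [Xl pil] := lift_holonomyP lx.
    by split=> //=; rewrite pil; split; [exact: psif|exact: psi_DT].
  + move=> x z /set_mem lx /set_mem lz /(congr1 pi).
    rewrite (lift_holonomyP lx).2 (lift_holonomyP lz).2.
    have [[Xx [Ex dx]] [Xz [Ez dz]]] := (lx, lz).
    by move=> /psii xz; apply: preimage_uniq => //; apply: xz; rewrite inE.
  + move=> x [Xx [/= Fx dx]]; have [y Ey yx] := psis _ Fx.
    have dy : DT y.
      apply: (doubly_transitive_gibbs (gibbs_relation_sym (rel _ Ey))).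
      by rewrite yx.
    have [Xc pic] := code_inverseP dy.
    exists (c y); first by split=> //=; rewrite pic.
    by rewrite /lift_holonomy pic yx code_inverseK.
- apply: (@measurable_comp _ _ _ _ _ _ DT c _ (psi \o pi)) => //.
    by move=> _ [x [Xx [Ex dx]] <-] /=; exact: psi_DT.
  apply: (@measurable_comp _ _ _ _ _ _ E psi _ pi) => //.
    by move=> _ [x [Xx [Ex dx]] <-].
  by apply: measurable_funS mpi => //; exact: subIsetl.
- move=> G mG GE; rewrite lift_holonomy_image//; apply: mpi => //.
  apply: mpsiI; first exact: mc.
  by move=> y [dy /GE[_ []]] /=; rewrite (code_inverseP dy).2.
Qed.

Lemma lift_holonomy_holonomy :
  holonomy X (lift_dom E) (lift_dom F) lift_holonomy.
Proof.
split; [exact: subIsetl|exact: subIsetl|exact: lift_borel_isomorphism|].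
move=> x lx; have [Xx [Ex dx]] := lx; have [Xl pil] := lift_holonomyP lx.
apply: (gibbs_relation_preimage X_finite_type pi_factor) => //.
  by move=> z Xz; exact: preimage_uniq.
by rewrite pil; exact: (holonomy_rel h).
Qed.

Lemma lift_holonomy_derivative : \forall x \ae mu,
  X x -> holonomy_derivative nu h (pi x) =
         holonomy_derivative mu lift_holonomy_holonomy x.
Proof.
pose mpf := isMeasurableFun.Build _ _ _ _ p mp.
pose pf : {mfun _ >-> _} := HB.pack p mpf.
have transfer := @Radon_Nikodym_transfer _ _ _ _ R mu nu
  (charge_of_finite_measure
    (transport_measure mu (holonomy_iso lift_holonomy_holonomy)))
  (charge_of_finite_measure (transport_measure nu (holonomy_iso h)))
  pf q mq nuE.
have : \forall x \ae mu, holonomy_derivative nu h (p x) =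
    holonomy_derivative mu lift_holonomy_holonomy x.
  apply: transfer => //.
  - move=> G mG; rewrite /= /transport_measure.
    have [_ _ [mE _ _ _ mpsiI] _] := h.
    have [mE' _ _ _ mliftI] := lift_borel_isomorphism.
    have mpG : measurable (p @^-1` G) by exact: mpreim.
    rewrite nu_def; last by apply: mpsiI; [exact: measurableI|exact: subIsetl].
    apply: (eq_measure_setD mN0) => //.
    + by apply: mpi => //; apply: mpsiI; [exact: measurableI|exact: subIsetl].
    + by apply: mliftI; [exact: measurableI|exact: subIsetl].
    rewrite lift_holonomy_image; last exact: subIsetl.
    apply/seteqP; split=> x [[Xx [y]]].
      move=> [Ey Gy] yx nx; have [_ dx] := notN0 nx.
      split=> //; split=> //; exists y => //.
      have dy : DT y.
        apply: (doubly_transitive_gibbs (gibbs_relation_sym (holonomy_rel h Ey))).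
        by rewrite yx.
      have [Xc pic] := code_inverseP dy.
      by split=> //; split; [split=> //=; rewrite pic|rewrite /= pE// pic].
    move=> [dy [[Xc [/= Ey _]] Gy]] yx nx; have [_ pic] := code_inverseP dy.
    split=> //; split=> //; exists y => //.
    by move: Ey Gy; rewrite /= pE// pic.
  - exact: transport_measure_dominated.
  - by apply: transport_measure_dominated => //; exact: pushforward_nonsingular.
by apply: filterS => x + Xx; rewrite pE.
Qed.

End lifted_holonomy.

(** At [c y] the derivative of the lift equals the derivative of [psi] at [y], and the Gibbs
    property of [mu] evaluates it; the lift takes [c y] to [c (psi y)]. *)
Lemma pushforward_gibbs phi : gibbs X mu phi -> gibbs_factor X Y pi nu phi.
Proof.
move=> [_ mu_gibbs]; split; first exact: pushforward_nonsingular.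
move=> E F psi h.
have der := ae_code_inverse (lift_holonomy_derivative h).
have gib := ae_code_inverse (mu_gibbs _ _ _ (lift_holonomy_holonomy h)).
apply: filterS3 pushforward_ae_doubly_transitive der gib.
move=> y dy /(_ dy) der /(_ dy) gib Ey.
have [Xc pic] := code_inverseP dy.
have lc : lift_dom E (c y) by split=> //=; rewrite pic.
have dpsi : DT (psi y) := doubly_transitive_gibbs (holonomy_rel h Ey) dy.
split=> //.
  have := holonomy_rel (lift_holonomy_holonomy h) lc.
  by rewrite /lift_holonomy pic.
by rewrite -[in LHS]pic der// gib// /lift_holonomy pic.
Qed.

End factor_measure.

Theorem proposition3p9 (R : realType) (A B : pointedFinType)
    (X : set (full_shift A)) (Y : set (full_shift B))
    (pi : full_shift A -> full_shift B)
    (mu : probability (full_shift A) R) (nu : probability (full_shift B) R)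
    (X_irreducible : irreducible_shift X)
    (X_finite_type : shift_of_finite_type X)
    (Y_sofic : sofic Y)
    (pi_factor : factor_code X Y pi) (pi_inv : almost_invertible X Y pi)
    (mu_on_X : mu X = 1%E)
    (mu_supp : fully_supported X mu)
    (mu_inv : shift_invariant mu)
    (mu_erg : shift_ergodic mu)
    (mu_nonsing : gibbs_nonsingular X mu)
    (nu_def : is_pushforward X pi mu nu) :
  [/\ gibbs_nonsingular Y nu,
      \forall y \ae nu, doubly_transitive Y y &
      forall phi : full_shift A * full_shift A -> R,
        cocycle X phi -> gibbs X mu phi -> gibbs_factor X Y pi nu phi].
Proof.
split.
- exact: (pushforward_nonsingular X_finite_type pi_factor pi_inv mu_on_X mu_supp
    mu_inv mu_erg mu_nonsing nu_def).
- exact: (pushforward_ae_doubly_transitive pi_factor mu_on_X mu_supp mu_inv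
    mu_erg nu_def).
- move=> phi _; exact: (pushforward_gibbs X_finite_type pi_factor pi_inv mu_on_X
    mu_supp mu_inv mu_erg mu_nonsing nu_def).
Qed.
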